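(* Let $S,T\in\operatorname{End}(V\otimes V)$ be of six-vertex form and suppose $$a_1(S)a_2(S)+b_1(S)b_2(S)-c_1(S)c_2(S)=a_1(T)a_2(T)+b_1(T)b_2(T)-c_1(T)c_2(T)=0,$$ with $c_1(T)c_2(T)\neq0$ (so that $\pi(T)$ is invertible). Let $R$ be the element of six-vertex form defined by $\pi(R)=\pi(S)\,\pi(T)^{-1}$. Then $\llbracket R,S,T\rrbracket=0$, and moreover $$a_1(R)a_2(R)+b_1(R)b_2(R)-c_1(R)c_2(R)=0.$$
   Context: Let $V$ be a two-dimensional complex vector space with basis $v_+,v_-$. Identify $\operatorname{End}(V\otimes V)$ with $4\times4$ matrices using the ordered basis $v_+\otimes v_+,\ v_+\otimes v_-,\ v_-\otimes v_+,\ v_-\otimes v_-$. An endomorphism is of six-vertex form if its matrix is $$R=\begin{pmatrix}a_1&0&0&0\\0&b_1&c_1&0\\0&c_2&b_2&0\\0&0&0&a_2\end{pmatrix},$$ and we write $a_1(R)=a_1$, etc. Define $$\pi(R)=\begin{pmatrix}c_1&0&0&0\\0&a_1&b_2&0\\0&-b_1&a_2&0\\0&0&0&c_2\end{pmatrix}.$$ (Any matrix with this block shape is $\pi$ of a unique $R$ of six-vertex form.) For $\phi\in\operatorname{End}(V\otimes V)$ define $\phi_{12},\phi_{13},\phi_{23}\in\operatorname{End}(V\otimes V\otimes V)$ by requiring, for $\phi=\phi'\otimes\phi''$, $\phi_{12}=\phi'\otimes\phi''\otimes1$, $\phi_{13}=\phi'\otimes1\otimes\phi''$, $\phi_{23}=1\otimes\phi'\otimes\phi''$,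 extended linearly; and $\llbracket\phi,\psi,\chi\rrbracket=\phi_{12}\psi_{13}\chi_{23}-\chi_{23}\psi_{13}\phi_{12}$. *)

(* Defs.v *)
From HB Require Import structures.
From mathcomp Require Import all_boot all_order all_algebra.
From mathcomp Require Import reals.
From mathcomp Require Import complex mxtens ring.

Set Implicit Arguments.
Unset Strict Implicit.
Unset Printing Implicit Defensive.

Import GRing.Theory.
Local Open Scope ring_scope.

(* The basis v_+, v_- of V is indexed by 'I_2.  [mxtens_index (i, j)] has value
   2 * i + j, so 'I_(2 * 2) enumerates v_+ v_+, v_+ v_-, v_- v_+, v_- v_- in
   this order, and [A *t B] is the matrix of A (x) B in that basis. *)
Definition vp : 'I_2 := 0.
Definition vm : 'I_2 := 1.
Definition vv (i j : 'I_2) : 'I_(2 * 2) := mxtens_index (i, j).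

Fact vv_order :
  [/\ vv vp vp = 0 :> nat, vv vp vm = 1 :> nat,
      vv vm vp = 2 :> nat & vv vm vm = 3 :> nat]%N.
Proof. by []. Qed.

Section SixVertex.
Variable F : comNzRingType.
Implicit Types (R phi psi chi : 'M[F]_(2 * 2)).

Definition mx_of_rows (rows : seq (seq F)) : 'M[F]_(2 * 2) :=
  \matrix_(i, j) nth 0 (nth [::] rows i) j.

Definition six_vertex_mx (a1 a2 b1 b2 c1 c2 : F) : 'M[F]_(2 * 2) :=
  mx_of_rows [:: [:: a1;  0;  0;  0];
                 [::  0; b1; c1;  0];
                 [::  0; c2; b2;  0];
                 [::  0;  0;  0; a2]].

Definition six_vertex R : Prop :=
  exists a1 a2 b1 b2 c1 c2, R = six_vertex_mx a1 a2 b1 b2 c1 c2.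

Definition a1 R : F := R (vv vp vp) (vv vp vp).
Definition a2 R : F := R (vv vm vm) (vv vm vm).
Definition b1 R : F := R (vv vp vm) (vv vp vm).
Definition b2 R : F := R (vv vm vp) (vv vm vp).
Definition c1 R : F := R (vv vp vm) (vv vm vp).
Definition c2 R : F := R (vv vm vp) (vv vp vm).

Fact six_vertex_mxE (x1 x2 y1 y2 z1 z2 : F) :
  let R := six_vertex_mx x1 x2 y1 y2 z1 z2 in
  (a1 R = x1 /\ a2 R = x2) /\ (b1 R = y1 /\ b2 R = y2) /\
  (c1 R = z1 /\ c2 R = z2).
Proof. by rewrite /a1 /a2 /b1 /b2 /c1 /c2 !mxE. Qed.

Definition sv_pi R : 'M[F]_(2 * 2) :=
  mx_of_rows [:: [:: c1 R;      0;    0;    0];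
                 [::    0;   a1 R; b2 R;    0];
                 [::    0; - b1 R; a2 R;    0];
                 [::    0;      0;    0; c2 R]].

(* The linear extension to End(V (x) V) of a map given on pure tensors by a
   bilinear f: since phi = \sum phi_{(i,k),(j,l)} E_ij (x) E_kl, it sends phi to
   \sum phi_{(i,k),(j,l)} f(E_ij, E_kl). *)
Definition tens_ext (f : 'M[F]_2 -> 'M[F]_2 -> 'M[F]_(2 * 2 * 2)) phi :
    'M[F]_(2 * 2 * 2) :=
  \sum_(i < 2) \sum_(j < 2) \sum_(k < 2) \sum_(l < 2)
    phi (vv i k) (vv j l) *: f (delta_mx i j) (delta_mx k l).

Definition leg12 := tens_ext (fun A B => A *t B *t 1%:M).
Definition leg13 := tens_ext (fun A B => A *t 1%:M *t B).
Definition leg23 := tens_ext (fun A B => 1%:M *t A *t B).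

Fact tens_ext_tens f (A B : 'M[F]_2) :
    (forall Y c X X', f (c *: X + X') Y = c *: f X Y + f X' Y) ->
    (forall X c Y Y', f X (c *: Y + Y') = c *: f X Y + f X Y') ->
  tens_ext f (A *t B) = f A B.
Proof.
have lin_sum (g : 'M[F]_2 -> 'M[F]_(2 * 2 * 2)) (X : 'M[F]_2) :
    (forall c Y Y', g (c *: Y + Y') = c *: g Y + g Y') ->
    g X = \sum_i \sum_j X i j *: g (delta_mx i j).
  move=> lin_g.
  have g0 : g 0 = 0.
    by have := lin_g (-1) 0 0; rewrite scaler0 addr0 scaleN1r addNr.
  have gD Y Y' : g (Y + Y') = g Y + g Y'.
    by have := lin_g 1 Y Y'; rewrite !scale1r.
  rewrite {1}(matrix_sum_delta X) (big_morph g gD g0); apply: eq_bigr => i _.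
  rewrite (big_morph g gD g0); apply: eq_bigr => j _.
  by rewrite -[_ *: _]addr0 lin_g g0 addr0.
move=> lin1 lin2; rewrite (lin_sum (f^~ B) A (lin1 B)) /tens_ext.
apply: eq_bigr => i _; apply: eq_bigr => j _.
rewrite (lin_sum _ B (lin2 (delta_mx i j))) scaler_sumr.
apply: eq_bigr => k _; rewrite scaler_sumr; apply: eq_bigr => l _.
by rewrite /vv tensmxE scalerA.
Qed.

Fact leg12_tens (A B : 'M[F]_2) : leg12 (A *t B) = A *t B *t 1%:M.
Proof.
by apply: tens_ext_tens => [B' c X X'|A' c Y Y']; apply/matrixP => x y;
   rewrite !mxE; ring.
Qed.

Fact leg13_tens (A B : 'M[F]_2) : leg13 (A *t B) = A *t 1%:M *t B.
Proof.
by apply: tens_ext_tens => [B' c X X'|A' c Y Y']; apply/matrixP => x y;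
   rewrite !mxE; ring.
Qed.

Fact leg23_tens (A B : 'M[F]_2) : leg23 (A *t B) = 1%:M *t A *t B.
Proof.
by apply: tens_ext_tens => [B' c X X'|A' c Y Y']; apply/matrixP => x y;
   rewrite !mxE; ring.
Qed.

Definition yb_bracket phi psi chi : 'M[F]_(2 * 2 * 2) :=
  leg12 phi *m leg13 psi *m leg23 chi - leg23 chi *m leg13 psi *m leg12 phi.

End SixVertex.

(* Main.v *)
(** Writing the hypothesis as [sv_pi S = sv_pi R *m sv_pi T] makes the entries
    of S polynomials in those of R and T.  The free fermion condition equates
    the determinant [a1 * a2 + b1 * b2] of the middle 2 x 2 block of [sv_pi]
    with [c1 * c2]; both are multiplicative, so R inherits it from S and T.
    The Yang-Baxter equation then amounts to the 64 scalar identities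
      \sum_(a, b, c) R(ij; ab) S(ak; i'c) T(bc; j'k') =
      \sum_(a, b, c) T(jk; bc) S(ic; ak') R(ab; i'j'),
    each of which lies in the ideal of the free fermion relations of R and T. *)
Require Import Defs.
From HB Require Import structures.
From mathcomp Require Import all_boot all_order all_algebra.
From mathcomp Require Import reals.
From mathcomp Require Import complex mxtens.
From mathcomp Require Import ring.

Set Implicit Arguments.
Unset Strict Implicit.
Unset Printing Implicit Defensive.

Import GRing.Theory.
Local Open Scope ring_scope.

(** * Entries of the three legs and of their triple products *)

Section Legs.
Variable F : comNzRingType.
Implicit Types (phi psi chi : 'M[F]_(2 * 2)) (i j k : 'I_2).

Definition vvv i j k : 'I_(2 * 2 * 2) := mxtens_index (vv i j, k).

Lemma vvvP (x : 'I_(2 * 2 * 2)) : exists i j k, x = vvv i j k.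
Proof.
case: (mxtens_indexP x) => y k; case: (mxtens_indexP y) => i j.
by exists i, j, k.
Qed.

Lemma sum_mxtens_index m n (f : 'I_(m * n) -> F) :
  \sum_x f x = \sum_i \sum_j f (mxtens_index (i, j)).
Proof.
rewrite pair_big (reindex (@mxtens_index m n)) /=.
  by apply: eq_bigr => -[].
exists (@mxtens_unindex m n) => x _.
  exact: mxtens_indexK.
exact: mxtens_unindexK.
Qed.

Lemma sum_vvv (f : 'I_(2 * 2 * 2) -> F) :
  \sum_x f x = \sum_i \sum_j \sum_k f (vvv i j k).
Proof. by rewrite sum_mxtens_index sum_mxtens_index. Qed.

(** Used mostly from right to left: a closed term is expanded into a sum, so that two sides can be
    compared summand by summand. *)
Lemma sum_kronecker n (f : 'I_n -> F) (i : 'I_n) :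
  \sum_j f j * (i == j)%:R = f i.
Proof.
rewrite (bigD1 i) //= eqxx mulr1 big1 ?addr0 // => j.
by rewrite eq_sym => /negPf ->; rewrite mulr0.
Qed.

Lemma tens_extE f phi x y :
  tens_ext f phi x y = \sum_i \sum_j \sum_k \sum_l
    phi (vv i k) (vv j l) * f (delta_mx i j) (delta_mx k l) x y.
Proof.
rewrite /tens_ext summxE; apply: eq_bigr => i _.
rewrite summxE; apply: eq_bigr => j _.
rewrite summxE; apply: eq_bigr => k _.
by rewrite summxE; apply: eq_bigr => l _; rewrite mxE.
Qed.

Lemma sum_delta_mx phi i j i' j' :
  \sum_a \sum_a' \sum_b \sum_b' phi (vv a b) (vv a' b') *
    ((delta_mx a a' : 'M[F]_2) i i' * (delta_mx b b' : 'M[F]_2) j j') =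
  phi (vv i j) (vv i' j').
Proof.
rewrite -[RHS](sum_kronecker (fun a => phi (vv a j) (vv i' j'))).
apply: eq_bigr => a _.
rewrite -(sum_kronecker (fun a' => phi (vv a j) (vv a' j'))) mulr_suml.
apply: eq_bigr => a' _.
rewrite -(sum_kronecker (fun b => phi (vv a b) (vv a' j'))) !mulr_suml.
apply: eq_bigr => b _.
rewrite -(sum_kronecker (fun b' => phi (vv a b) (vv a' b'))) !mulr_suml.
(* An entry of [delta_mx] is the cast of a conjunction; it splits into a product of two Kronecker
   deltas. *)
by apply: eq_bigr => b' _; rewrite !mxE -!mulnb !natrM; ring.
Qed.

Lemma leg12E phi i j k i' j' k' :
  leg12 phi (vvv i j k) (vvv i' j' k') =
  phi (vv i j) (vv i' j') * (k == k')%:R.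
Proof.
rewrite /leg12 tens_extE -(sum_delta_mx phi i j i' j').
do 4 (rewrite mulr_suml; apply: eq_bigr => ? _).
by rewrite /vvv /vv !tensmxE [1%:M _ _]mxE !mulrA.
Qed.

Lemma leg13E phi i j k i' j' k' :
  leg13 phi (vvv i j k) (vvv i' j' k') =
  phi (vv i k) (vv i' k') * (j == j')%:R.
Proof.
rewrite /leg13 tens_extE -(sum_delta_mx phi i k i' k').
do 4 (rewrite mulr_suml; apply: eq_bigr => ? _).
by rewrite /vvv /vv !tensmxE [1%:M _ _]mxE; ring.
Qed.

Lemma leg23E phi i j k i' j' k' :
  leg23 phi (vvv i j k) (vvv i' j' k') =
  phi (vv j k) (vv j' k') * (i == i')%:R.
Proof.
rewrite /leg23 tens_extE -(sum_delta_mx phi j k j' k').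
do 4 (rewrite mulr_suml; apply: eq_bigr => ? _).
by rewrite /vvv /vv !tensmxE [1%:M _ _]mxE; ring.
Qed.

(** The leg 12 preserves the third index and the leg 13 the second, so only the first intermediate
    index stays free. *)
Lemma leg12_13E phi psi i j k i' j' k' :
  (leg12 phi *m leg13 psi) (vvv i j k) (vvv i' j' k') =
  \sum_a phi (vv i j) (vv a j') * psi (vv a k) (vv i' k').
Proof.
rewrite mxE sum_vvv; apply: eq_bigr => a _.
rewrite -(sum_kronecker (fun b => phi (vv i j) (vv a b) * _)).
apply: eq_bigr => b _.
rewrite -(sum_kronecker (fun c => phi _ _ * psi (vv a c) _)) mulr_suml.
by apply: eq_bigr => c _; rewrite leg12E leg13E (eq_sym b); ring.
Qed.

Lemma leg23_13E psi chi i j k i' j' k' :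
  (leg23 chi *m leg13 psi) (vvv i j k) (vvv i' j' k') =
  \sum_c chi (vv j k) (vv j' c) * psi (vv i c) (vv i' k').
Proof.
rewrite mxE sum_vvv.
rewrite -(sum_kronecker (fun a => \sum_c chi _ _ * psi (vv a c) _)).
apply: eq_bigr => a _.
rewrite -(sum_kronecker (fun b => \sum_c chi _ (vv b c) * _)) mulr_suml.
apply: eq_bigr => b _; rewrite !mulr_suml.
by apply: eq_bigr => c _; rewrite leg23E leg13E (eq_sym b); ring.
Qed.

Lemma leg12_13_23E phi psi chi i j k i' j' k' :
  (leg12 phi *m leg13 psi *m leg23 chi) (vvv i j k) (vvv i' j' k') =
  \sum_a \sum_b \sum_c phi (vv i j) (vv a b) * psi (vv a k) (vv i' c) *
    chi (vv b c) (vv j' k').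
Proof.
(* With [b] and [c] outermost, the inner sum on the left collapses by the delta of [leg23], and the
   one on the right is an entry of the product of the first two legs. *)
rewrite mxE sum_vvv exchange_big [RHS]exchange_big; apply: eq_bigr => b _ /=.
rewrite exchange_big [RHS]exchange_big; apply: eq_bigr => c _ /=.
rewrite -mulr_suml -leg12_13E.
rewrite -(sum_kronecker (fun x => (_ *m _) _ (vvv x b c))) mulr_suml.
by apply: eq_bigr => x _; rewrite leg23E (eq_sym x); ring.
Qed.

Lemma leg23_13_12E phi psi chi i j k i' j' k' :
  (leg23 chi *m leg13 psi *m leg12 phi) (vvv i j k) (vvv i' j' k') =
  \sum_a \sum_b \sum_c chi (vv j k) (vv b c) * psi (vv i c) (vv a k') *
    phi (vv a b) (vv i' j').
Proof.
rewrite mxE sum_vvv; apply: eq_bigr => a _; apply: eq_bigr => b _.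
rewrite -mulr_suml -leg23_13E.
rewrite -(sum_kronecker (fun x => (_ *m _) _ (vvv a b x))) mulr_suml.
by apply: eq_bigr => x _; rewrite leg12E (eq_sym x); ring.
Qed.

End Legs.

(** * Algebra of six-vertex matrices and the Yang-Baxter identity *)

Lemma ord2P (i : 'I_2) : i = vp \/ i = vm.
Proof. by case: i => -[|[|//]] p; [left|right]; apply: val_inj. Qed.

Lemma eq_vp : ((vp == vp) = true) * ((vm == vp) = false).
Proof. by []. Qed.

Lemma big_ord2 (F : nmodType) (f : 'I_2 -> F) : \sum_i f i = f vp + f vm.
Proof.
by rewrite !big_ord_recl big_ord0 addr0; congr (f _ + f _); apply: val_inj.
Qed.

(** Only the tests [== vp] occur on the right, so splitting on these booleans leaves polynomials for
    [ring]. *)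
Lemma six_vertex_mx_vv (F : comNzRingType) (x1 x2 y1 y2 z1 z2 : F) i j k l :
  six_vertex_mx x1 x2 y1 y2 z1 z2 (vv i j) (vv k l) =
  if i == vp then
    if j == vp then (if (k == vp) && (l == vp) then x1 else 0)
    else if k == vp then (if l == vp then 0 else y1)
    else (if l == vp then z1 else 0)
  else
    if j == vp then
      if k == vp then (if l == vp then 0 else z2)
      else (if l == vp then y2 else 0)
    else (if (k == vp) || (l == vp) then 0 else x2).
Proof.
rewrite mxE; have [->|->] := ord2P i; have [->|->] := ord2P j;
by have [->|->] := ord2P k; have [->|->] := ord2P l.
Qed.

(** The middle argument is the [S] obtained by reading the entries of [sv_pi R *m sv_pi T] back
    through [sv_pi]. *)
Lemma yb_bracket_six_vertex (F : comNzRingType) (x1 x2 y1 y2 z1 z2 : F)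
    (a1 a2 b1 b2 c1 c2 : F) :
    z1 * z2 = x1 * x2 + y1 * y2 -> c1 * c2 = a1 * a2 + b1 * b2 ->
  yb_bracket (six_vertex_mx x1 x2 y1 y2 z1 z2)
    (six_vertex_mx (x1 * a1 - y2 * b1) (x2 * a2 - y1 * b2)
       (y1 * a1 + x2 * b1) (x1 * b2 + y2 * a2) (z1 * c1) (z2 * c2))
    (six_vertex_mx a1 a2 b1 b2 c1 c2) = 0.
Proof.
move=> ffR ffT; apply/eqP; rewrite subr_eq0; apply/eqP/matrixP => x y.
have [i [j [k ->]]] := vvvP x; have [i' [j' [k' ->]]] := vvvP y.
rewrite leg12_13_23E leg23_13_12E.
rewrite !big_ord2 !six_vertex_mx_vv !eq_vp /=.
case: (i == vp); case: (j == vp); case: (k == vp);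
case: (i' == vp); case: (j' == vp); case: (k' == vp) => /=;
(* Each identity needs at most one of the two free fermion relations. *)
by [ring | ring: ffR | ring: ffT].
Qed.

Lemma mulmx_six_vertex (F : comNzRingType) (x1 x2 y1 y2 z1 z2 : F)
    (x1' x2' y1' y2' z1' z2' : F) :
  six_vertex_mx x1 x2 y1 y2 z1 z2 *m six_vertex_mx x1' x2' y1' y2' z1' z2' =
  six_vertex_mx (x1 * x1') (x2 * x2') (y1 * y1' + z1 * z2')
    (z2 * z1' + y2 * y2') (y1 * z1' + z1 * y2') (z2 * y1' + y2 * z2').
Proof.
apply/matrixP => x y.
case: (mxtens_indexP x) => i j; case: (mxtens_indexP y) => k l.
rewrite mxE sum_mxtens_index !big_ord2 -!/(vv _ _) !six_vertex_mx_vv !eq_vp /=.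
by case: (i == vp); case: (j == vp); case: (k == vp); case: (l == vp) => /=;
  ring.
Qed.

Lemma six_vertex_mx1 (F : comNzRingType) :
  six_vertex_mx 1 1 1 1 0 0 = 1%:M :> 'M[F]_(2 * 2).
Proof.
apply/matrixP => x y.
case: (mxtens_indexP x) => i j; case: (mxtens_indexP y) => k l.
rewrite mxE [RHS]mxE.
by have [->|->] := ord2P i; have [->|->] := ord2P j;
  have [->|->] := ord2P k; have [->|->] := ord2P l.
Qed.

(** Makes the product and injectivity lemmas for six-vertex matrices available for values of
    [sv_pi]. *)
Lemma sv_piE (F : comNzRingType) (R : 'M[F]_(2 * 2)) :
  sv_pi R = six_vertex_mx (c1 R) (c2 R) (a1 R) (a2 R) (b2 R) (- b1 R).
Proof. by []. Qed.

Lemma six_vertex_mx_inj (F : comNzRingType) (x1 x2 y1 y2 z1 z2 : F)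
    (x1' x2' y1' y2' z1' z2' : F) :
    six_vertex_mx x1 x2 y1 y2 z1 z2 = six_vertex_mx x1' x2' y1' y2' z1' z2' ->
  [/\ x1 = x1' /\ x2 = x2', y1 = y1' /\ y2 = y2' & z1 = z1' /\ z2 = z2'].
Proof.
have := six_vertex_mxE x1' x2' y1' y2' z1' z2'.
have := six_vertex_mxE x1 x2 y1 y2 z1 z2.
set R := six_vertex_mx _ _ _ _ _ _; set R' := six_vertex_mx _ _ _ _ _ _.
move=> /= [[<- <-] [[<- <-] [<- <-]]] [[<- <-] [[<- <-] [<- <-]]] eqR.
by rewrite !eqR.
Qed.

Lemma six_vertexE (F : comNzRingType) (R : 'M[F]_(2 * 2)) :
  six_vertex R ->
  R = six_vertex_mx (a1 R) (a2 R) (b1 R) (b2 R) (c1 R) (c2 R).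
Proof.
case=> [x1 [x2 [y1 [y2 [z1 [z2 defR]]]]]].
have := six_vertex_mxE x1 x2 y1 y2 z1 z2; rewrite /= -defR.
by move=> [[-> ->] [[-> ->] [-> ->]]].
Qed.

Lemma sv_pi_inj (F : comNzRingType) (R R' : 'M[F]_(2 * 2)) :
  six_vertex R -> six_vertex R' -> sv_pi R = sv_pi R' -> R = R'.
Proof.
move=> /six_vertexE defR /six_vertexE defR'.
rewrite !sv_piE => /six_vertex_mx_inj[[ec1 ec2] [ea1 ea2] [eb2 /oppr_inj eb1]].
by rewrite defR defR' ea1 ea2 eb1 eb2 ec1 ec2.
Qed.

(** With [sv_pi_inj], this makes [sv_pi] a bijection of the six-vertex matrices onto themselves. *)
Lemma sv_pi_six_vertex_mx (F : comNzRingType) (x1 x2 y1 y2 z1 z2 : F) :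
  sv_pi (six_vertex_mx y1 y2 (- z2) z1 x1 x2) =
  six_vertex_mx x1 x2 y1 y2 z1 z2.
Proof.
rewrite sv_piE; have := six_vertex_mxE y1 y2 (- z2) z1 x1 x2.
set R := six_vertex_mx _ _ _ _ _ _ => -[[-> ->] [[-> ->] [-> ->]]].
by rewrite opprK.
Qed.

(** * Inverting [sv_pi T] and transferring the free fermion condition *)

Section FreeFermion.
Variable F : fieldType.
Implicit Types R S T : 'M[F]_(2 * 2).

(** The middle block is the adjugate of that of [sv_pi T] divided by [D], which is its determinant
    under the free fermion condition. *)
Definition sv_pi_inv T : 'M[F]_(2 * 2) :=
  let D := c1 T * c2 T in
  six_vertex_mx (c1 T)^-1 (c2 T)^-1 (a2 T / D) (a1 T / D)
    (- b2 T / D) (b1 T / D).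

Lemma mulmx_sv_pi_inv T :
    a1 T * a2 T + b1 T * b2 T = c1 T * c2 T -> c1 T * c2 T != 0 ->
  sv_pi T *m sv_pi_inv T = 1%:M.
Proof.
move=> ffT cT; have /norP[c1T c2T] : ~~ ((c1 T == 0) || (c2 T == 0)).
  by rewrite -mulf_eq0.
rewrite sv_piE mulmx_six_vertex -six_vertex_mx1 !mulfV //; congr six_vertex_mx.
(* Write 1 as [D / D] with the numerator expanded as the determinant. *)
- by rewrite -[RHS](mulfV cT) -[X in _ = X / _]ffT; ring.
- by rewrite -[RHS](mulfV cT) -[X in _ = X / _]ffT; ring.
- by ring.
- by ring.
Qed.

Lemma yb_bracket_sv_pi R S T :
    six_vertex R -> six_vertex S -> six_vertex T ->
    a1 S * a2 S + b1 S * b2 S = c1 S * c2 S ->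
    a1 T * a2 T + b1 T * b2 T = c1 T * c2 T -> c1 T * c2 T != 0 ->
    sv_pi S = sv_pi R *m sv_pi T ->
  yb_bracket R S T = 0 /\ a1 R * a2 R + b1 R * b2 R = c1 R * c2 R.
Proof.
move=> /six_vertexE defR /six_vertexE defS /six_vertexE defT ffS ffT cT.
rewrite !sv_piE mulmx_six_vertex.
rewrite mulrN mulNr [- _ + _]addrC.
move=> /six_vertex_mx_inj[[ec1 ec2] [ea1 ea2] [eb2 eb1N]].
have eb1 : b1 S = b1 R * a1 T + a2 R * b1 T by rewrite -[LHS]opprK eb1N; ring.
have ffR : a1 R * a2 R + b1 R * b2 R = c1 R * c2 R.
  (* After multiplication by the nonzero [c1 T * c2 T], what remains is multiplicativity of the 2 x
     2 determinant. *)
  apply: (mulIf cT); transitivity (c1 S * c2 S); last by rewrite ec1 ec2; ring.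
  by rewrite -ffS -ffT ea1 ea2 eb1 eb2; ring.
split=> //; have := yb_bracket_six_vertex (esym ffR) (esym ffT).
by rewrite -defR -defT -ec1 -ec2 -eb1 -eb2 -ea1 -ea2 -defS.
Qed.

End FreeFermion.

(** The first two clauses justify defining [R] through its image under [sv_pi]. *)
Theorem theorem2 (K : realType) (S T : 'M[K[i]]_(2 * 2))
    (hS : six_vertex S) (hT : six_vertex T)
    (ffS : a1 S * a2 S + b1 S * b2 S - c1 S * c2 S = 0)
    (ffT : a1 T * a2 T + b1 T * b2 T - c1 T * c2 T = 0)
    (cT : c1 T * c2 T != 0) :
  [/\ sv_pi T \in unitmx,
      (exists! R : 'M[K[i]]_(2 * 2),
         six_vertex R /\ sv_pi R = sv_pi S *m invmx (sv_pi T)) &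
      forall R : 'M[K[i]]_(2 * 2),
        six_vertex R -> sv_pi R = sv_pi S *m invmx (sv_pi T) ->
        yb_bracket R S T = 0 /\
        a1 R * a2 R + b1 R * b2 R - c1 R * c2 R = 0].
Proof.
move/subr0_eq in ffS; move/subr0_eq in ffT.
have piTK := mulmx_sv_pi_inv ffT cT.
have [piTu _] := mulmx1_unit piTK.
have invpiT : invmx (sv_pi T) = sv_pi_inv T.
  by rewrite -[LHS]mulmx1 -piTK mulKmx.
split=> // [|R sixR defR]; last first.
  have piS : sv_pi S = sv_pi R *m sv_pi T by rewrite defR mulmxKV.
  have [-> ffR] := yb_bracket_sv_pi sixR hS hT ffS ffT cT piS.
  by rewrite ffR subrr.
(* The quotient is again of six-vertex form, hence the image under [sv_pi] of an explicit [R]. *)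
rewrite invpiT sv_piE /sv_pi_inv mulmx_six_vertex -sv_pi_six_vertex_mx.
set R := six_vertex_mx _ _ _ _ _ _; have sixR : six_vertex R by do 6!eexists.
exists R; split=> // R' [sixR' eqR].
exact/esym/sv_pi_inj.
Qed.
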